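(* Let $X$ and $Y$ be compact Hausdorff spaces, and let $E\subseteq C(X)$ and $F\subseteq C(Y)$ be Riesz subspaces, dense for the supremum norm, containing the respective constant functions. Let $G$ be an Archimedean Riesz space and $\phi:E\times F\to G$ a Riesz bimorphism, and let $\chi:E\times F\to C(X\times Y)$ be the natural bilinear embedding, $\chi(f,g)(x,y)=f(x)g(y)$. Let $E\overline{\otimes}_\chi F$ be the Riesz subspace of $C(X\times Y)$ generated by $\chi(E\times F)$. Then there is a unique Riesz homomorphism $T:E\overline{\otimes}_\chi F\to G$ such that $\phi=T\circ\chi$. Furthermore, if $\phi$ is bi-injective then $T$ is a Riesz isomorphism of $E\overline{\otimes}_\chi F$ onto $E\overline{\otimes}_\phi F$, the Riesz subspace of $G$ generated by $\phi(E\times F)$.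
   Context: A linear map $T$ between Riesz spaces is a Riesz homomorphism if $T(x\vee y)=Tx\vee Ty$. A bilinear map $\phi:E\times F\to G$ is a Riesz bimorphism if $\phi(\cdot,y)$ is a Riesz homomorphism for every $y\in F_+$ and $\phi(x,\cdot)$ is a Riesz homomorphism for every $x\in E_+$. $\phi$ is bi-injective if $\phi(x,y)=0$ implies $x=0$ or $y=0$. *)

(* Defs.v *)
From HB Require Import structures.
From mathcomp Require Import all_boot all_order all_algebra.
From mathcomp Require Import all_classical all_reals.
From mathcomp Require Import topology normedtype.
Set Implicit Arguments. Unset Strict Implicit. Unset Printing Implicit Defensive.
Import Order.TTheory GRing.Theory Num.Theory.
Import numFieldNormedType.Exports.
Local Open Scope ring_scope.

Definition riesz_space (R : realType) (G : lmodType R)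
    (le : G -> G -> Prop) (join : G -> G -> G) : Prop :=
  [/\ [/\ (forall x, le x x),
          (forall x y, le x y -> le y x -> x = y) &
          (forall x y z, le x y -> le y z -> le x z)],
      (forall x y z, le x y -> le (x + z) (y + z)),
      (forall (a : R) x y, 0 <= a -> le x y -> le (a *: x) (a *: y))
    & (forall x y, [/\ le x (join x y), le y (join x y) &
                      forall z, le x z -> le y z -> le (join x y) z])].

Definition archimedean_riesz (R : realType) (G : lmodType R)
    (le : G -> G -> Prop) : Prop :=
  forall x y : G, le 0 x -> (forall n : nat, le (x *+ n) y) -> x = 0.

Definition riesz_subspace (R : realType) (G : lmodType R)
    (join : G -> G -> G) (S : G -> Prop) : Prop :=
  [/\ S 0,
      (forall x y, S x -> S y -> S (x + y)),
      (forall (a : R) x, S x -> S (a *: x))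
    & (forall x y, S x -> S y -> S (join x y))].

Definition riesz_generated (R : realType) (G : lmodType R)
    (join : G -> G -> G) (A : G -> Prop) : G -> Prop :=
  fun u => forall S, riesz_subspace join S -> (forall v, A v -> S v) -> S u.

Definition Criesz_subspace (R : realType) (X : topologicalType)
    (S : (X -> R) -> Prop) : Prop :=
  [/\ (forall f, S f -> continuous f),
      S (fun _ => 0),
      (forall f g, S f -> S g -> S (fun x => f x + g x)),
      (forall (a : R) f, S f -> S (fun x => a * f x))
    & (forall f g, S f -> S g -> S (fun x => Num.max (f x) (g x)))].

Definition contains_constants (R : realType) (X : Type)
    (S : (X -> R) -> Prop) : Prop := forall c : R, S (fun _ => c).

Definition sup_dense (R : realType) (X : topologicalType)
    (S : (X -> R) -> Prop) : Prop :=
  forall f : X -> R, continuous f -> forall e : R, 0 < e ->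
    exists g, S g /\ forall x, `|f x - g x| < e.

Definition Criesz_generated (R : realType) (X : topologicalType)
    (A : (X -> R) -> Prop) : (X -> R) -> Prop :=
  fun h => forall S, Criesz_subspace S -> (forall f, A f -> S f) -> S h.

Definition riesz_hom_on (R : realType) (X : Type) (G : lmodType R)
    (join : G -> G -> G) (D : (X -> R) -> Prop) (T : (X -> R) -> G) : Prop :=
  [/\ (forall f g, D f -> D g -> T (fun x => f x + g x) = T f + T g),
      (forall (a : R) f, D f -> T (fun x => a * f x) = a *: T f)
    & (forall f g, D f -> D g ->
         T (fun x => Num.max (f x) (g x)) = join (T f) (T g))].

Definition fpos (R : realType) (X : Type) (S : (X -> R) -> Prop) (f : X -> R) :=
  S f /\ forall x, 0 <= f x.

Definition riesz_bimorphism (R : realType) (X Y : Type) (G : lmodType R)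
    (join : G -> G -> G) (E : (X -> R) -> Prop) (F : (Y -> R) -> Prop)
    (phi : (X -> R) -> (Y -> R) -> G) : Prop :=
  [/\ (forall g, F g -> forall f f', E f -> E f' ->
          phi (fun x => f x + f' x) g = phi f g + phi f' g) /\
      (forall g, F g -> forall (a : R) f, E f ->
          phi (fun x => a * f x) g = a *: phi f g),
      (forall f, E f -> forall g g', F g -> F g' ->
          phi f (fun y => g y + g' y) = phi f g + phi f g') /\
      (forall f, E f -> forall (a : R) g, F g ->
          phi f (fun y => a * g y) = a *: phi f g),
      (forall g, fpos F g -> riesz_hom_on join E (fun f => phi f g))
    & (forall f, fpos E f -> riesz_hom_on join F (fun g => phi f g))].

Definition bi_injective (R : realType) (X Y : Type) (G : lmodType R)
    (E : (X -> R) -> Prop) (F : (Y -> R) -> Prop)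
    (phi : (X -> R) -> (Y -> R) -> G) : Prop :=
  forall f g, E f -> F g -> phi f g = 0 -> f = (fun _ => 0) \/ g = (fun _ => 0).

Definition chi (R : realType) (X Y : Type) (f : X -> R) (g : Y -> R) :
  X * Y -> R := fun p => f p.1 * g p.2.

Definition tensor_chi (R : realType) (X Y : topologicalType)
    (E : (X -> R) -> Prop) (F : (Y -> R) -> Prop) : (X * Y -> R) -> Prop :=
  Criesz_generated (fun h => exists f g, [/\ E f, F g & h = chi f g]).

Definition tensor_phi (R : realType) (X Y : Type) (G : lmodType R)
    (join : G -> G -> G) (E : (X -> R) -> Prop) (F : (Y -> R) -> Prop)
    (phi : (X -> R) -> (Y -> R) -> G) : G -> Prop :=
  riesz_generated join (fun u => exists f g, [/\ E f, F g & u = phi f g]).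

(* Main.v *)
(* With e = phi(1,1), the relation between functions on X * Y and elements of G
   generated, as a Riesz subspace, by the pairs (chi(f,g), phi(f,g)) is the graph of T;
   the point is that it is single-valued. If (h, v) is in it then near every (x0, y0)
   the element v looks like h(x0, y0) e: for each eps > 0 there are positive p in E and
   q in F, nonzero at x0 and y0, such that |v - h(x0, y0) e| <= eps e + s for some
   s >= 0 disjoint from phi(p, q). This property is stable under the Riesz operations.
   If h = 0, then (|v| - eps e)^+ is disjoint from phi(p, q) for enough p and q to give,
   by compactness, disjointness from e itself; being dominated by a multiple of e it is
   zero, so |v| <= eps e for all eps, and v = 0 as G is Archimedean. If (h, 0) is in the
   relation and h(x0, y0) <> 0, then e, hence phi(p, q), is disjoint from phi(p, q),
   so phi(p, q) = 0, which bi-injectivity excludes. *)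
Require Import Defs.
From HB Require Import structures.
From mathcomp Require Import all_boot all_order all_algebra.
From mathcomp Require Import all_classical all_reals.
From mathcomp Require Import topology normedtype.
From mathcomp Require Import lra.
Import Order.TTheory GRing.Theory Num.Theory.
Import numFieldNormedType.Exports.
Local Open Scope ring_scope.
Local Open Scope classical_set_scope.
Set Implicit Arguments. Unset Strict Implicit. Unset Printing Implicit Defensive.

(** * Order arithmetic in a Riesz space *)

Section RieszSpace.
Context {R : realType} {G : lmodType R} {le : G -> G -> Prop} {join : G -> G -> G}.

(* Disjointness of positive elements, phrased without the infimum. *)
Definition disj (s w : G) := forall z, le z s -> le z w -> le z 0.

(** This is |v| <= u, split into two inequalities so that each half can be handled by order
    arithmetic alone. *)
Definition abs_le (v u : G) := le v u /\ le (- v) u.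

Hypothesis rG : riesz_space le join.

Lemma gle_refl x : le x x.
Proof. by case: rG => -[]. Qed.

Lemma gle_anti x y : le x y -> le y x -> x = y.
Proof. by case: rG => -[_ + _] *; auto. Qed.

Lemma gle_trans y x z : le x y -> le y z -> le x z.
Proof. by case: rG => -[_ _ + _ _ _]; apply. Qed.

Lemma gleD x y x' y' : le x y -> le x' y' -> le (x + x') (y + y').
Proof.
case: rG => _ leD _ _ xy xy'; apply: (@gle_trans (y + x')); first exact: leD.
by rewrite ![y + _]addrC; apply: leD.
Qed.

Lemma gle_subl x y z : le (x - y) z <-> le x (z + y).
Proof.
split=> h; first by rewrite -[x](subrK y); apply: gleD => //; apply: gle_refl.
by rewrite -[z](addrK y); apply: gleD => //; apply: gle_refl.
Qed.

Lemma gsubr_ge0 x y : le 0 (y - x) -> le x y.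
Proof. by move=> h; rewrite -[y](subrK x) -{1}[x]add0r; apply: gleD (gle_refl _). Qed.

Lemma gleN x y : le x y -> le (- y) (- x).
Proof. by move=> xy; rewrite -sub0r gle_subl addrC -gle_subl opprK add0r. Qed.

Lemma gleZ (a : R) x y : 0 <= a -> le x y -> le (a *: x) (a *: y).
Proof. by case: rG => _ _ + _; apply. Qed.

Lemma gleZ_ge0 (a : R) x : 0 <= a -> le 0 x -> le 0 (a *: x).
Proof. by move=> a0 x0; rewrite -(scaler0 _ a); apply: gleZ. Qed.

Lemma gleZ_pos (a : R) x y : 0 < a -> le (a *: x) (a *: y) -> le x y.
Proof.
move=> a0 xy; rewrite -[x]scale1r -[y]scale1r -(mulVf (lt0r_neq0 a0)) -!scalerA.
by apply: gleZ => //; rewrite invr_ge0 ltW.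
Qed.

Lemma gleZl (a b : R) x : a <= b -> le 0 x -> le (a *: x) (b *: x).
Proof.
move=> ab x0; rewrite -[b](subrK a) scalerDl -{1}[a *: x]add0r.
by apply: gleD (gle_refl _); apply: gleZ_ge0; rewrite ?subr_ge0.
Qed.

Lemma gaddr_ge0 x y : le 0 x -> le 0 y -> le 0 (x + y).
Proof. by move=> x0 y0; rewrite -[0]addr0; apply: gleD. Qed.

Lemma gle_addr x y : le 0 y -> le x (x + y).
Proof. by move=> y0; rewrite -{1}[x]addr0; apply: gleD => //; apply: gle_refl. Qed.

Lemma gle_addl x y : le 0 y -> le x (y + x).
Proof. by rewrite addrC; apply: gle_addr. Qed.

Lemma gle_joinl x y : le x (join x y).
Proof. by case: rG => _ _ _ /(_ x y) []. Qed.

Lemma gle_joinr x y : le y (join x y).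
Proof. by case: rG => _ _ _ /(_ x y) []. Qed.

Lemma gjoin_le x y z : le x z -> le y z -> le (join x y) z.
Proof. by case: rG => _ _ _ /(_ x y) [_ _ +]; apply. Qed.

Lemma gjoin_idPr x y : le x y -> join x y = y.
Proof.
move=> xy; apply: gle_anti; last exact: gle_joinr.
exact: gjoin_le xy (gle_refl _).
Qed.

Lemma gjoin_idPl x y : le y x -> join x y = x.
Proof.
move=> yx; apply: gle_anti; last exact: gle_joinl.
exact: gjoin_le (gle_refl _) yx.
Qed.

Lemma gjoinZ_max (a b : R) x : le 0 x -> join (a *: x) (b *: x) = Num.max a b *: x.
Proof.
move=> x0; case: (leP a b) => ab; first by apply: gjoin_idPr; apply: gleZl.
by apply: gjoin_idPl; apply: gleZl => //; apply: ltW.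
Qed.

(** * Bounds on absolute values *)

Lemma abs_leW v u u' : abs_le v u -> le u u' -> abs_le v u'.
Proof. by case=> vu Nvu uu'; split; apply: (@gle_trans u). Qed.

Lemma abs_le0 u : le 0 u -> abs_le 0 u.
Proof. by split; rewrite ?oppr0. Qed.

Lemma abs_le_ge0 v u : abs_le v u -> le 0 u.
Proof.
case=> vu Nvu; apply: (@gleZ_pos 2%:R); first by rewrite ltr0n.
by rewrite scaler0 scaler_nat mulr2n -(subrr v); apply: gleD.
Qed.

Lemma abs_leD v u v' u' : abs_le v u -> abs_le v' u' -> abs_le (v + v') (u + u').
Proof. by move=> [? ?] [? ?]; split; rewrite ?opprD; apply: gleD. Qed.

Lemma abs_leZ (a : R) v u : abs_le v u -> abs_le (a *: v) (`|a| *: u).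
Proof.
move=> [vu Nvu]; case: (ger0P a) => a0.
  by split; rewrite -?scalerN; apply: gleZ.
rewrite -[a in a *: v]opprK scaleNr -scalerN.
by split; rewrite -?scalerN ?opprK; apply: gleZ => //; rewrite oppr_ge0 ltW.
Qed.

(** Both [v <= v1 + u] and [v' <= v1' + u'] are bounded by [join v1 v1' + (u + u')]; the other half
    exchanges [v, v'] with [v1, v1']. *)
Lemma abs_le_join v v1 v' v1' u u' : abs_le (v - v1) u -> abs_le (v' - v1') u' ->
  abs_le (join v v' - join v1 v1') (u + u').
Proof.
have half w w1 w' w1' : le 0 u -> le 0 u' -> le (w - w1) u -> le (w' - w1') u' ->
    le (join w w' - join w1 w1') (u + u').
  move=> u0 u'0 /gle_subl h /gle_subl h'; apply/gle_subl; apply: gjoin_le.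
    apply: (gle_trans h); apply: gleD (gle_joinl _ _); exact: gle_addr.
  apply: (gle_trans h'); apply: gleD (gle_joinr _ _); exact: gle_addl.
move=> a a'; have u0 := abs_le_ge0 a; have u'0 := abs_le_ge0 a'.
move: a a' => [a Na] [a' Na']; split; first exact: half.
by rewrite opprB; apply: half => //; rewrite -opprB.
Qed.

(** * Disjointness of positive elements, and approximation up to disjoint errors *)

Lemma disjC s w : disj s w -> disj w s.
Proof. by move=> d z zw zs; apply: d. Qed.

Lemma disjW s w s' w' : disj s w -> le s' s -> le w' w -> disj s' w'.
Proof. by move=> d ss ww z zs zw; apply: d; [apply: gle_trans ss|apply: gle_trans ww]. Qed.

(** If [z] is below [s + s'] and [w], then [z - s] is below [s'] and, as [s >= 0], below [w]; so
    [z <= s], and then [z <= 0]. *)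
Lemma disjD s s' w : le 0 s -> disj s w -> disj s' w -> disj (s + s') w.
Proof.
move=> s0 d d' z zs zw; apply: d => //.
suff : le (z - s) 0 by rewrite gle_subl add0r.
by apply: d'; rewrite gle_subl; [rewrite addrC|apply: (gle_trans zw); apply: gle_addr].
Qed.

(** For [a <= 1] the multiple is below [s]; for [a > 1] a common lower bound is divided by [a],
    which keeps it below [w]. *)
Lemma disjZ (a : R) s w : 0 <= a -> le 0 s -> le 0 w -> disj s w -> disj (a *: s) w.
Proof.
move=> a0 s0 w0 d; case: (leP a 1) => a1.
  by apply: (disjW d); [rewrite -{2}[s]scale1r; apply: gleZl|apply: gle_refl].
have ap : 0 < a by apply: lt_trans a1.
move=> z zs zw; apply: (@gleZ_pos a^-1); first by rewrite invr_gt0.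
rewrite scaler0; apply: d.
  by rewrite -[s]scale1r -(mulVf (lt0r_neq0 ap)) -scalerA; apply: gleZ; rewrite // invr_ge0 ltW.
apply: (@gle_trans (a^-1 *: w)); first by apply: gleZ => //; rewrite invr_ge0 ltW.
rewrite -{2}[w]scale1r; apply: gleZl => //.
by rewrite invf_le1 // ltW.
Qed.

(** Here [s] is also disjoint from [a *: w], and is itself a common lower bound of the two. *)
Lemma disj_multiple (a : R) s w : 0 <= a -> le 0 s -> le 0 w ->
  disj s w -> le s (a *: w) -> s = 0.
Proof.
move=> a0 s0 w0 d sw; apply: gle_anti => //.
have d' := disjC (disjZ a0 w0 s0 (disjC d)).
by apply: d' => //; apply: gle_refl.
Qed.

Lemma abs_le_small e v : archimedean_riesz le ->
  (forall eps : R, 0 < eps -> abs_le v (eps *: e)) -> v = 0.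
Proof.
move=> aG h; have e0 : le 0 e by rewrite -[e]scale1r; apply: (abs_le_ge0 (h 1 ltr01)).
pose a := join v (- v).
have a0 : le 0 a by apply: (@abs_le_ge0 v); split; [apply: gle_joinl|apply: gle_joinr].
have a00 : a = 0.
  (* With [a] = |v| and [eps] = 1/(n+1), the hypothesis reads (n+1)|v| <= e; the multiple by 0 is
     treated apart. *)
  apply: (aG a e) => // -[|n]; first by rewrite mulr0n.
  have n0 : 0 < n.+1%:R^-1 :> R by rewrite invr_gt0 ltr0n.
  apply: (@gleZ_pos n.+1%:R^-1) => //.
  rewrite -(scaler_nat n.+1 a) scalerA mulVf ?pnatr_eq0 // scale1r.
  by case: (h _ n0) => vn Nvn; apply: gjoin_le.
have v0 : le v 0 by rewrite -a00; apply: gle_joinl.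
have Nv0 : le (- v) 0 by rewrite -a00; apply: gle_joinr.
by apply: gle_anti => //; rewrite -[v]opprK -oppr0; apply: gleN.
Qed.

(** Seen from [w], [v] is [c *: e] up to [eps *: e]: the error [s] may be large, but [w] does not
    detect it. *)
Definition near_mult (e w : G) (eps : R) (v : G) (c : R) :=
  exists s, [/\ le 0 s, disj s w & abs_le (v - c *: e) (eps *: e + s)].

Lemma near_multW e w w' eps eps' v c : le 0 e -> eps <= eps' -> le w' w ->
  near_mult e w eps v c -> near_mult e w' eps' v c.
Proof.
move=> e0 ee ww [s [s0 sw vs]]; exists s; split=> //.
  by apply: (disjW sw) => //; apply: gle_refl.
by apply: (abs_leW vs); apply: gleD (gle_refl _); apply: gleZl.
Qed.

Lemma near_mult_refl e w (eps c : R) : 0 <= eps -> le 0 e ->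
  near_mult e w eps (c *: e) c.
Proof.
move=> eps0 e0; exists 0; split; [exact: gle_refl|by move=> z|].
by rewrite subrr addr0; apply: abs_le0; apply: gleZ_ge0.
Qed.

Lemma near_multD e w eps eps' v v' c c' :
  near_mult e w eps v c -> near_mult e w eps' v' c' ->
  near_mult e w (eps + eps') (v + v') (c + c').
Proof.
move=> [s [s0 sw vs]] [s' [s'0 sw' vs']]; exists (s + s'); split=> //.
- exact: gaddr_ge0.
- exact: disjD.
- rewrite !scalerDl opprD (addrACA v) (addrACA (eps *: e)).
  exact: abs_leD.
Qed.

Lemma near_multZ e w eps v c (a : R) : le 0 w ->
  near_mult e w eps v c -> near_mult e w (`|a| * eps) (a *: v) (a * c).
Proof.
move=> w0 [s [s0 sw vs]]; exists (`|a| *: s); split=> //.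
- exact: gleZ_ge0.
- exact: disjZ.
- by rewrite -!scalerA -scalerDr -scalerBr; apply: abs_leZ.
Qed.

(** Since [e >= 0], the join of [c *: e] and [c' *: e] is [Num.max c c' *: e], so [abs_le_join]
    gives the estimate. *)
Lemma near_mult_join e w eps eps' v v' c c' : le 0 e ->
  near_mult e w eps v c -> near_mult e w eps' v' c' ->
  near_mult e w (eps + eps') (join v v') (Num.max c c').
Proof.
move=> e0 [s [s0 sw vs]] [s' [s'0 sw' vs']]; exists (s + s'); split=> //.
- exact: gaddr_ge0.
- exact: disjD.
- by rewrite scalerDl (addrACA (eps *: e)) -gjoinZ_max //; apply: abs_le_join.
Qed.

End RieszSpace.

(** * Riesz subspaces of continuous functions, and compactness *)

Section FunctionSpace.
Context {R : realType} {X : topologicalType} {E : (X -> R) -> Prop}.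
Hypotheses (rE : Criesz_subspace E) (kE : contains_constants E).

Lemma CrieszD f g : E f -> E g -> E (fun x => f x + g x).
Proof. by case: rE => _ _ + _ _; apply. Qed.

Lemma CrieszZ (a : R) f : E f -> E (fun x => a * f x).
Proof. by case: rE => _ _ _ + _; apply. Qed.

Lemma Criesz_max f g : E f -> E g -> E (fun x => Num.max (f x) (g x)).
Proof. by case: rE => _ _ _ _; apply. Qed.

Lemma CrieszN f : E f -> E (fun x => - f x).
Proof.
move=> /(CrieszZ (-1)); congr E.
by apply/funext => x; rewrite mulN1r.
Qed.

Lemma CrieszB f g : E f -> E g -> E (fun x => f x - g x).
Proof. by move=> Ef /CrieszN; apply: CrieszD. Qed.

Lemma Criesz_min f g : E f -> E g -> E (fun x => Num.min (f x) (g x)).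
Proof.
move=> Ef Eg; have := CrieszN (Criesz_max (CrieszN Ef) (CrieszN Eg)).
by congr E; apply/funext => x; rewrite oppr_max !opprK.
Qed.

Lemma Criesz_norm f : E f -> E (fun x => `|f x|).
Proof.
move=> Ef; have := Criesz_max Ef (CrieszN Ef).
by congr E; apply/funext => x; rewrite maxrN.
Qed.

Lemma fpos_cst (c : R) : 0 <= c -> fpos E (fun _ => c).
Proof. by split. Qed.

Lemma fpos_min f g : fpos E f -> fpos E g -> fpos E (fun x => Num.min (f x) (g x)).
Proof.
by move=> [Ef f0] [Eg g0]; split=> [|x]; [apply: Criesz_min|rewrite le_min f0 g0].
Qed.

Lemma fposD f g : fpos E f -> fpos E g -> fpos E (fun x => f x + g x).
Proof.
by move=> [Ef f0] [Eg g0]; split=> [|x]; [apply: CrieszD|apply: addr_ge0].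
Qed.

Lemma fposZ (a : R) f : 0 <= a -> fpos E f -> fpos E (fun x => a * f x).
Proof.
by move=> a0 [Ef f0]; split=> [|x]; [apply: CrieszZ|apply: mulr_ge0].
Qed.

End FunctionSpace.

(** Otherwise the sets where [p < 1], for [p] in [Q], generate a proper filter: they are nonempty,
    and p + p' < 1 forces p < 1 and p' < 1. At a cluster point some multiple of a member of [Q]
    exceeds 1, a contradiction. *)
Lemma compact_sum_ge1 (R : realType) (X : topologicalType) (Q : (X -> R) -> Prop) :
  compact [set: X] ->
  (forall p, Q p -> continuous p /\ forall x, 0 <= p x) ->
  Q (fun _ => 0) ->
  (forall p p', Q p -> Q p' -> Q (fun x => p x + p' x)) ->
  (forall (a : R) p, 0 <= a -> Q p -> Q (fun x => a * p x)) ->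
  (forall x0, exists p, Q p /\ 0 < p x0) ->
  exists p, Q p /\ forall x, 1 <= p x.
Proof.
move=> cX Qc Q0 QD QZ Qx; apply: contrapT => nQ.
pose B (p : X -> R) := [set x : X | p x < 1].
have FF : ProperFilter (filter_from Q B).
  apply: filter_from_proper.
    apply: filter_from_filter; first by exists (fun _ => 0).
    move=> p p' Qp Qp'; exists (fun x => p x + p' x); first exact: QD.
    move=> x; have [_ /(_ x) p0] := Qc _ Qp; have [_ /(_ x) p'0] := Qc _ Qp'.
    by rewrite /B /=; split=> /=; lra.
  move=> p Qp; apply: contrapT => /set0P/negP/negbNE/eqP B0.
  apply: nQ; exists p; split=> // x; rewrite leNgt; apply/negP => px.
  by have : set0 x by rewrite -B0.
have [|x [_ clx]] := cX _ FF; first by exists (fun _ => 0).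
have [p [Qp px]] := Qx x.
(* Scaled to take the value 2 at [x], so that [p1 > 1] on a neighbourhood of [x], which misses
   [B p1]. *)
pose p1 (y : X) := (2 / p x) * p y.
have Qp1 : Q p1 by apply: QZ => //; rewrite divr_ge0 // ltW.
have p1x : 1 < p1 x by rewrite /p1 divfK ?gt_eqF // ltr1n.
have [||y [/= + +]] := clx (B p1) [set y | 1 < p1 y]; first by exists p1.
  have [/(_ x) c _] := Qc _ Qp1; apply: (c [set r | 1 < r]).
  by apply: open_nbhs_nbhs; split => //; apply: open_gt.
by rewrite /B /=; lra.
Qed.

Lemma continuous_compact_bound (R : realType) (X : topologicalType) (f : X -> R) :
  compact [set: X] -> continuous f ->
  exists M : R, 0 <= M /\ forall x, `|f x| <= M.
Proof.
move=> cX cf.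
have := @continuous_compact _ _ f setT (continuous_subspaceT cf) cX.
(* [M] may be negative and only reals strictly above it are known to be bounds; hence this
   choice. *)
move=> /compact_bounded [M [_ hM]]; exists (`|M| + 1); split.
  by rewrite addr_ge0.
move=> x; apply: (hM (`|M| + 1)); last by exists x.
by rewrite (le_lt_trans (ler_norm M)) // ltrDl.
Qed.

Lemma Criesz_bound (R : realType) (X : topologicalType) (E : (X -> R) -> Prop) f :
  Criesz_subspace E -> compact [set: X] -> E f ->
  exists M : R, 0 <= M /\ forall x, `|f x| <= M.
Proof. by case=> cE _ _ _ _ cX /cE; apply: continuous_compact_bound. Qed.

(** Transfers every fact about the first variable to the second. *)
Lemma riesz_bimorphismC (R : realType) (X Y : Type) (G : lmodType R)
    (join : G -> G -> G) (E : (X -> R) -> Prop) (F : (Y -> R) -> Prop) phi :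
  riesz_bimorphism join E F phi -> riesz_bimorphism join F E (fun g f => phi f g).
Proof. by case=> a b c d; split. Qed.

(** * Bimorphisms in one variable *)

Section Bimorphism.
Context {R : realType} {X Y : topologicalType} {G : lmodType R}.
Context {le : G -> G -> Prop} {join : G -> G -> G}.
Context {E : (X -> R) -> Prop} {F : (Y -> R) -> Prop}.
Context {phi : (X -> R) -> (Y -> R) -> G}.
Hypotheses (rG : riesz_space le join) (bphi : riesz_bimorphism join E F phi).
Hypotheses (rE : Criesz_subspace E) (kE : contains_constants E).
Hypotheses (rF : Criesz_subspace F) (kF : contains_constants F).

Lemma bimDl f f' g : E f -> E f' -> F g ->
  phi (fun x => f x + f' x) g = phi f g + phi f' g.
Proof. by case: bphi => -[D _] _ _ _ *; apply: D. Qed.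

Lemma bimZl (a : R) f g : E f -> F g -> phi (fun x => a * f x) g = a *: phi f g.
Proof. by case: bphi => -[_ Z] _ _ _ *; apply: Z. Qed.

Lemma bim_cstl (a : R) g : F g -> phi (fun _ => a) g = a *: phi (fun _ => 1) g.
Proof.
move=> Fg; rewrite -bimZl //; congr phi; apply/funext => x.
by rewrite mulr1.
Qed.

Lemma bim0l g : F g -> phi (fun _ => 0) g = 0.
Proof. by move=> Fg; rewrite bim_cstl // scale0r. Qed.

Lemma bim_lel f f' g : E f -> E f' -> fpos F g -> (forall x, f x <= f' x) ->
  le (phi f g) (phi f' g).
Proof.
move=> Ef Ef' Fg ff'; have [_ _ /(_ f f' Ef Ef')] : riesz_hom_on join E (phi^~ g).
  by case: bphi => _ _ + _; apply.
have -> : (fun x => Num.max (f x) (f' x)) = f'.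
  by apply/funext => x; apply/max_idPr.
by move=> ->; apply: gle_joinl rG _ _.
Qed.

Lemma bim_ge0 f g : fpos E f -> fpos F g -> le 0 (phi f g).
Proof.
by move=> [Ef f0] Fg; rewrite -(bim0l Fg.1); apply: bim_lel.
Qed.

(** The pointwise minimum of [f] and [f'] is 0, that is, max(-f, -f') = 0. The homomorphism
    [phi^~ g] preserves this join, so for a common lower bound [z] of the images, [- z] is above a
    join equal to 0. *)
Lemma bim_disjl f f' g : fpos E f -> fpos E f' -> fpos F g ->
  (forall x, f x = 0 \/ f' x = 0) -> @disj _ _ le (phi f g) (phi f' g).
Proof.
move=> [Ef f0] [Ef' f'0] Fg ff' z zf zf'; have Fg1 := Fg.1.
have [_ Z /(_ _ _ (CrieszN rE Ef) (CrieszN rE Ef'))] : riesz_hom_on join E (phi^~ g).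
  by case: bphi => _ _ + _; apply.
have phiN u : E u -> phi (fun x => - u x) g = - phi u g.
  move=> Eu; rewrite -scaleN1r -bimZl //; congr phi.
  by apply/funext => x; rewrite mulN1r.
rewrite !phiN //.
have -> : (fun x => Num.max (- f x) (- f' x)) = (fun _ => 0).
  apply/funext => x; rewrite -oppr_min; have := f0 x; have := f'0 x.
  by case: (ff' x) => -> h h'; [rewrite min_l|rewrite min_r]; rewrite ?oppr0.
rewrite bim0l // => j0.
rewrite -[z]opprK -oppr0; apply: (gleN rG); rewrite {1}j0.
by apply: (gjoin_le rG); apply: (gleN rG).
Qed.

End Bimorphism.

(** * Bimorphisms in both variables, and local values *)

Section Tensor.
Context {R : realType} {X Y : topologicalType} {G : lmodType R}.
Context {le : G -> G -> Prop} {join : G -> G -> G}.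
Context {E : (X -> R) -> Prop} {F : (Y -> R) -> Prop}.
Context {phi : (X -> R) -> (Y -> R) -> G}.
Hypotheses (rG : riesz_space le join) (bphi : riesz_bimorphism join E F phi).
Hypotheses (rE : Criesz_subspace E) (kE : contains_constants E).
Hypotheses (rF : Criesz_subspace F) (kF : contains_constants F).

Lemma bimDr f g g' : E f -> F g -> F g' ->
  phi f (fun y => g y + g' y) = phi f g + phi f g'.
Proof. by move=> Ef Fg Fg'; apply: (bimDl (riesz_bimorphismC bphi)). Qed.

Lemma bimZr (a : R) f g : E f -> F g -> phi f (fun y => a * g y) = a *: phi f g.
Proof. by move=> Ef Fg; apply: (bimZl (riesz_bimorphismC bphi)). Qed.

Lemma bim_cstr (a : R) f : E f -> phi f (fun _ => a) = a *: phi f (fun _ => 1).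
Proof. by move=> Ef; apply: (bim_cstl (riesz_bimorphismC bphi)). Qed.

Lemma bim0r f : E f -> phi f (fun _ => 0) = 0.
Proof. by move=> Ef; apply: (bim0l (riesz_bimorphismC bphi)). Qed.

Lemma bim_ler f g g' : fpos E f -> F g -> F g' -> (forall y, g y <= g' y) ->
  le (phi f g) (phi f g').
Proof. by move=> Ef Fg Fg'; apply: (bim_lel rG (riesz_bimorphismC bphi)). Qed.

Lemma bim_le f f' g g' : fpos E f -> E f' -> F g -> fpos F g' ->
  (forall x, f x <= f' x) -> (forall y, g y <= g' y) -> le (phi f g) (phi f' g').
Proof.
move=> Ef Ef' Fg Fg' ff' gg'; apply: (gle_trans rG (bim_ler Ef Fg Fg'.1 gg')).
exact: (bim_lel rG bphi Ef.1).
Qed.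

Local Notation e := (phi (fun _ => 1) (fun _ => 1)).

Lemma bim_unit_ge0 : le 0 e.
Proof. by apply: (bim_ge0 rG bphi kE); apply: fpos_cst. Qed.

(* 2 (phi(A,B) - phi(f,g)) = phi(A-f,B+g) + phi(A+f,B-g), a sum of positive terms. *)
Lemma bim_abs_le f A g B : E f -> E A -> F g -> F B ->
  (forall x, `|f x| <= A x) -> (forall y, `|g y| <= B y) ->
  abs_le (le := le) (phi f g) (phi A B).
Proof.
have half f' g' : E f' -> E A -> F g' -> F B ->
    (forall x, `|f' x| <= A x) -> (forall y, `|g' y| <= B y) ->
    le (phi f' g') (phi A B).
  move=> Ef EA Fg FB fA gB.
  have ENf := CrieszZ rE (-1) Ef; have FNg := CrieszZ rF (-1) Fg.
  have p1 : le 0 (phi (fun x => A x + -1 * f' x) (fun y => B y + g' y)).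
    apply: (bim_ge0 rG bphi kE); split; try exact: (CrieszD rE); try exact: (CrieszD rF).
      by move=> x; have := fA x; rewrite ler_norml => /andP[]; lra.
    by move=> y; have := gB y; rewrite ler_norml => /andP[]; lra.
  have p2 : le 0 (phi (fun x => A x + f' x) (fun y => B y + -1 * g' y)).
    apply: (bim_ge0 rG bphi kE); split; try exact: (CrieszD rE); try exact: (CrieszD rF).
      by move=> x; have := fA x; rewrite ler_norml => /andP[]; lra.
    by move=> y; have := gB y; rewrite ler_norml => /andP[]; lra.
  have := gaddr_ge0 rG p1 p2.
  rewrite !(bimDl bphi) ?bimDr ?(bimZl bphi) ?bimZr ?scaleN1r //;
    try exact: (CrieszD rF).
  set a := phi A B; set b := phi A g'; set c := phi f' B; set d := phi f' g'.
  have -> : a + b + (- c - d) + (a - b + (c - d)) = 2 *: (a - d).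
    rewrite addrACA (addrACA a) subrr addr0 (addrACA (- c)) addNr add0r.
    by rewrite scaler_nat mulr2n addrACA.
  by rewrite -{1}(scaler0 _ (2 : R)) => /(gleZ_pos rG)-/(_ ltac:(lra))/(gsubr_ge0 rG).
move=> Ef EA Fg FB fA gB; split; first exact: half.
(* The lower bound is the upper bound for [-f], which has the same majorant [A]. *)
rewrite -scaleN1r -(bimZl bphi) //; apply: half => //; first exact: (CrieszZ rE).
by move=> x; rewrite mulN1r normrN.
Qed.


(** An evaluation at [(x0, y0)] expressed inside [G]: the pair [p], [q], positive at the point,
    replaces a neighbourhood of it. *)
Definition local_value (x0 : X) (y0 : Y) (v : G) (c : R) :=
  forall eps : R, 0 < eps -> exists p q,
    [/\ fpos E p, fpos F q, 0 < p x0, 0 < q y0 &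
        near_mult (le := le) e (phi p q) eps v c].

Lemma local_value_cst x0 y0 (c : R) : local_value x0 y0 (c *: e) c.
Proof.
move=> eps eps0; exists (fun _ => 1), (fun _ => 1); split=> //; try exact: fpos_cst.
by apply: (near_mult_refl rG) => //; [apply: ltW|apply: bim_unit_ge0].
Qed.

Lemma local_valueZ x0 y0 (a : R) v c :
  local_value x0 y0 v c -> local_value x0 y0 (a *: v) (a * c).
Proof.
(* The summand 1 keeps the divisor positive when [a = 0]. *)
move=> lv eps eps0; have a0 : 0 < `|a| + 1 by rewrite ltr_wpDl.
have [p [q [Ep Fq p0 q0 n]]] := lv (eps / (`|a| + 1)) (divr_gt0 eps0 a0).
exists p, q; split=> //.
have pq0 : le 0 (phi p q) by apply: (bim_ge0 rG bphi kE).
apply: (near_multW rG bim_unit_ge0 _ (gle_refl rG _) (near_multZ rG a pq0 n)).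
by rewrite mulrCA ger_pMr // ler_pdivrMr // mul1r lerDl.
Qed.

(** Minima give one pair [p], [q] that serves both elements, since [near_mult] passes to smaller
    [w]; the halves of [eps] add up in sums and joins. *)
Lemma local_value_near2 x0 y0 v v' c c' eps :
  local_value x0 y0 v c -> local_value x0 y0 v' c' -> 0 < eps ->
  exists p q, [/\ fpos E p, fpos F q, 0 < p x0, 0 < q y0 &
    near_mult (le := le) e (phi p q) (eps / 2) v c /\
    near_mult (le := le) e (phi p q) (eps / 2) v' c'].
Proof.
move=> lv lv' eps0; have eps20 : 0 < eps / 2 by rewrite divr_gt0.
have [p [q [Ep Fq p0 q0 n]]] := lv _ eps20.
have [p' [q' [Ep' Fq' p'0 q'0 n']]] := lv' _ eps20.
have Em := fpos_min rE Ep Ep'; have Fm := fpos_min rF Fq Fq'.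
exists (fun x => Num.min (p x) (p' x)), (fun y => Num.min (q y) (q' y)).
split; rewrite ?lt_min ?p0 ?q0 //; split.
  apply: (near_multW rG bim_unit_ge0 _ _ n) => //.
  by apply: bim_le => //; [apply: Ep.1|apply: Fm.1|move=> x|move=> y]; rewrite ge_min lexx.
apply: (near_multW rG bim_unit_ge0 _ _ n') => //.
by apply: bim_le => //; [apply: Ep'.1|apply: Fm.1|move=> x|move=> y]; rewrite ge_min lexx orbT.
Qed.

Lemma local_valueD x0 y0 v v' c c' :
  local_value x0 y0 v c -> local_value x0 y0 v' c' ->
  local_value x0 y0 (v + v') (c + c').
Proof.
move=> lv lv' eps eps0.
have [p [q [Ep Fq p0 q0 [n n']]]] := local_value_near2 lv lv' eps0.
by exists p, q; split=> //; rewrite [eps]splitr; apply: (near_multD rG).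
Qed.

Lemma local_value_join x0 y0 v v' c c' :
  local_value x0 y0 v c -> local_value x0 y0 v' c' ->
  local_value x0 y0 (join v v') (Num.max c c').
Proof.
move=> lv lv' eps eps0.
have [p [q [Ep Fq p0 q0 [n n']]]] := local_value_near2 lv lv' eps0.
exists p, q; split=> //; rewrite [eps]splitr.
exact: (near_mult_join rG bim_unit_ge0).
Qed.

(* With d small, take p = (d - |f|)^+, which is disjoint from the excess (|f| - d)^+. *)
Lemma local_value_vanish x0 y0 f g (N : R) : E f -> F g -> 0 <= N ->
  (forall y, `|g y| <= N) -> f x0 = 0 -> local_value x0 y0 (phi f g) 0.
Proof.
move=> Ef Fg N0 gN fx0 eps eps0.
have N1 : 0 < N + 1 by rewrite ltr_wpDl.
(* Chosen so that [N * d <= eps], also when [N = 0]. *)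
pose d := eps / (N + 1); have d0 : 0 < d by rewrite divr_gt0.
pose r x : R := Num.max 0 (`|f x| - d); pose p x : R := Num.max 0 (d - `|f x|).
have Er : fpos E r.
  split=> [|x]; last by rewrite le_max lexx.
  by apply: Criesz_max => //; apply: CrieszB => //; apply: Criesz_norm.
have Ep : fpos E p.
  split=> [|x]; last by rewrite le_max lexx.
  by apply: Criesz_max => //; apply: CrieszB => //; apply: Criesz_norm.
have F1 : fpos F (fun _ => 1) by apply: fpos_cst.
have r0 : le 0 (phi r (fun _ => 1)) by apply: (bim_ge0 rG bphi kE).
exists p, (fun _ => 1); split=> //.
  by rewrite /p fx0 normr0 subr0 lt_max d0 orbT.
(* As |f| <= d + r and |g| <= N, |phi(f,g)| is at most phi(d + r, N) = N d e + N phi(r,1). *)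
exists (N *: phi r (fun _ => 1)); split.
- exact: (gleZ_ge0 rG).
- apply: (disjZ rG) => //; first by apply: (bim_ge0 rG bphi kE).
  apply: (bim_disjl rG bphi rE kE) => // x; rewrite /r /p.
  case: (leP `|f x| d) => fd; [left|right]; apply/max_idPl; lra.
- rewrite scale0r subr0.
  apply: (abs_leW (u := phi (fun x => d + r x) (fun _ => N)) rG).
    apply: bim_abs_le => // [|x]; first by apply: CrieszD => //; apply: Er.1.
    by rewrite /r; case: (leP 0 (`|f x| - d)) => ?; lra.
  rewrite bim_cstr; last by apply: CrieszD => //; apply: Er.1.
  rewrite (bimDl bphi) //; last exact: Er.1.
  rewrite (bim_cstl bphi kE d F1.1) scalerDr scalerA; apply: (gleD rG); last exact: (gle_refl rG).
  apply: (gleZl rG); last exact: bim_unit_ge0.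
  by rewrite /d mulrCA ger_pMr // ler_pdivrMr // mul1r lerDl.
Qed.

End Tensor.
Arguments local_value {R X Y G} le E F phi x0 y0 v c.

(** Lets [local_value_vanish] be used when the factor on [Y] is the one that vanishes. *)
Lemma local_valueC (R : realType) (X Y : topologicalType) (G : lmodType R) le
    (E : (X -> R) -> Prop) (F : (Y -> R) -> Prop) (phi : (X -> R) -> (Y -> R) -> G)
    x0 y0 v c :
  local_value le F E (fun g f => phi f g) y0 x0 v c -> local_value le E F phi x0 y0 v c.
Proof.
move=> lv eps eps0; have [q [p [Fq Ep q0 p0 n]]] := lv eps eps0.
by exists p, q.
Qed.

(** Each operation on functions is paired with its counterpart in [G]; facts about [T] then follow
    by induction on the generation of a pair. *)
Inductive tensor_graph (R : realType) (X Y : Type) (G : lmodType R)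
    (join : G -> G -> G) (E : (X -> R) -> Prop) (F : (Y -> R) -> Prop)
    (phi : (X -> R) -> (Y -> R) -> G) : (X * Y -> R) -> G -> Prop :=
| graph_chi f g : E f -> F g -> tensor_graph join E F phi (chi f g) (phi f g)
| graphD h h' v v' : tensor_graph join E F phi h v -> tensor_graph join E F phi h' v' ->
    tensor_graph join E F phi (fun z => h z + h' z) (v + v')
| graphZ (a : R) h v : tensor_graph join E F phi h v ->
    tensor_graph join E F phi (fun z => a * h z) (a *: v)
| graph_join h h' v v' : tensor_graph join E F phi h v ->
    tensor_graph join E F phi h' v' ->
    tensor_graph join E F phi (fun z => Num.max (h z) (h' z)) (join v v').

(** * The graph over the tensor product: local values, single-valuedness, injectivity *)

Section Factorization.
Context {R : realType} {X Y : topologicalType}.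
Hypotheses (cX : compact [set: X]) (cY : compact [set: Y]).
Context {E : (X -> R) -> Prop} {F : (Y -> R) -> Prop}.
Hypotheses (rE : Criesz_subspace E) (kE : contains_constants E).
Hypotheses (rF : Criesz_subspace F) (kF : contains_constants F).

Lemma tensor_chiD h h' : tensor_chi E F h -> tensor_chi E F h' ->
  tensor_chi E F (fun z => h z + h' z).
Proof. by move=> t t' S rS SA; case: (rS) => _ _ D _ _; apply: D; [apply: t|apply: t']. Qed.

Lemma tensor_chiZ (a : R) h : tensor_chi E F h -> tensor_chi E F (fun z => a * h z).
Proof. by move=> t S rS SA; case: (rS) => _ _ _ Z _; apply: Z; apply: t. Qed.

Lemma tensor_chi_max h h' : tensor_chi E F h -> tensor_chi E F h' ->
  tensor_chi E F (fun z => Num.max (h z) (h' z)).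
Proof. by move=> t t' S rS SA; case: (rS) => _ _ _ _ M; apply: M; [apply: t|apply: t']. Qed.

Lemma tensor_chi_chi f g : E f -> F g -> tensor_chi E F (chi f g).
Proof. by move=> Ef Fg S _ SA; apply: SA; exists f, g. Qed.

Lemma tensor_chi_ind (P : (X * Y -> R) -> Prop) :
  P (fun _ => 0) -> (forall f g, E f -> F g -> P (chi f g)) ->
  (forall h h', tensor_chi E F h -> tensor_chi E F h' -> P h -> P h' ->
     P (fun z => h z + h' z)) ->
  (forall (a : R) h, tensor_chi E F h -> P h -> P (fun z => a * h z)) ->
  (forall h h', tensor_chi E F h -> tensor_chi E F h' -> P h -> P h' ->
     P (fun z => Num.max (h z) (h' z))) ->
  forall h, tensor_chi E F h -> P h.
Proof.
move=> P0 Pchi PD PZ PM h th.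
have zero : tensor_chi E F (fun _ => 0) by move=> S [].
suff [] : [/\ continuous h, tensor_chi E F h & P h] by [].
(* Continuity is added because [Criesz_subspace] demands it, membership because the closure
   hypotheses on [P] assume it. *)
apply: (th (fun h => [/\ continuous h, tensor_chi E F h & P h])); last first.
  move=> _ [f [g [Ef Fg ->]]]; split; [|exact: tensor_chi_chi|exact: Pchi].
  have [cE _ _ _ _] := rE; have [cF _ _ _ _] := rF.
  move=> [x y]; rewrite /chi; apply: cvgM.
    by apply: (@continuous_comp _ _ _ fst f); [exact: cvg_fst|exact: (cE _ Ef x)].
  by apply: (@continuous_comp _ _ _ snd g); [exact: cvg_snd|exact: (cF _ Fg y)].
split.
- by move=> f [].
- by split=> //; move=> z; apply: cvg_cst.
- move=> f g [cf tf Pf] [cg tg Pg]; split; [|exact: tensor_chiD|exact: PD].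
  by move=> z; apply: cvgD; [apply: cf|apply: cg].
- move=> a f [cf tf Pf]; split; [|exact: tensor_chiZ|exact: PZ].
  by move=> z; apply: cvgMr; apply: cf.
- move=> f g [cf tf Pf] [cg tg Pg]; split; [|exact: tensor_chi_max|exact: PM].
  by move=> z; apply: continuous_max; [apply: cf|apply: cg].
Qed.

Context {G : lmodType R} {le : G -> G -> Prop} {join : G -> G -> G}.
Context {phi : (X -> R) -> (Y -> R) -> G}.
Hypotheses (rG : riesz_space le join) (aG : archimedean_riesz le).
Hypotheses (bphi : riesz_bimorphism join E F phi).

Local Notation e := (phi (fun _ => 1) (fun _ => 1)).
Local Notation graph := (tensor_graph join E F phi).

Lemma graph_tensor_chi h v : graph h v -> tensor_chi E F h.
Proof.
elim=> [f g Ef Fg|||]; first exact: tensor_chi_chi.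
- by move=> *; apply: tensor_chiD.
- by move=> *; apply: tensor_chiZ.
- by move=> *; apply: tensor_chi_max.
Qed.

Lemma tensor_chi_graph h : tensor_chi E F h -> exists v, graph h v.
Proof.
move=> th; pattern h; move: h th; apply: tensor_chi_ind.
- exists (phi (fun _ => 0) (fun _ => 0)).
  have -> : (fun _ : X * Y => 0 : R) = chi (fun _ => 0) (fun _ => 0).
    by apply/funext => z; rewrite /chi mulr0.
  exact: graph_chi.
- by move=> f g Ef Fg; exists (phi f g); apply: graph_chi.
- by move=> h h' _ _ [v gv] [v' gv']; exists (v + v'); apply: graphD.
- by move=> a h _ [v gv]; exists (a *: v); apply: graphZ.
- by move=> h h' _ _ [v gv] [v' gv']; exists (join v v'); apply: graph_join.
Qed.

(** With a = f(x0) and b = g(y0), phi(f,g) = phi(f-a,g) + a (phi(1,g-b) + b e); the terms with a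
    vanishing factor have local value 0. *)
Lemma local_value_bim x0 y0 f g : E f -> F g ->
  local_value le E F phi x0 y0 (phi f g) (f x0 * g y0).
Proof.
move=> Ef Fg; set a := f x0; set b := g y0.
have Efa : E (fun x => f x - a) by apply: CrieszB.
have Fgb : F (fun y => g y - b) by apply: CrieszB.
have -> : phi f g = phi (fun x => f x - a) g +
    a *: (phi (fun _ => 1) (fun y => g y - b) + b *: e).
  rewrite -(bim_cstr bphi kF b (kE 1)) -(bimDr bphi) // -(bim_cstl bphi kE a); last first.
    by have := CrieszD rF Fgb (kF b); congr F.
  have -> : (fun y => g y - b + b) = g by apply/funext => y; rewrite subrK.
  rewrite -(bimDl bphi) //; congr phi; apply/funext => x.
  by rewrite subrK.
have -> : a * b = 0 + a * (0 + b) by rewrite !add0r.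
have [N [N0 gN]] := Criesz_bound rF cY Fg.
apply: (local_valueD rG bphi rE kE rF kF).
  by apply: (local_value_vanish rG bphi rE kE rF kF y0 Efa Fg N0 gN); apply: subrr.
apply: (local_valueZ rG bphi kE kF); apply: (local_valueD rG bphi rE kE rF kF).
  apply: local_valueC; have bC := riesz_bimorphismC bphi.
  apply: (local_value_vanish rG bC rF kF rE kE x0 Fgb (kE 1) ler01); last exact: subrr.
  by move=> x; rewrite normr1.
exact: (local_value_cst rG bphi kE kF).
Qed.

Lemma graph_local_value h v x0 y0 : graph h v ->
  local_value le E F phi x0 y0 v (h (x0, y0)).
Proof.
elim=> [f g Ef Fg|h1 h2 v1 v2 _ l1 _ l2|a h1 v1 _ l1|h1 h2 v1 v2 _ l1 _ l2].
- exact: local_value_bim.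
- exact: (local_valueD rG bphi rE kE rF kF).
- exact: (local_valueZ rG bphi kE kF).
- exact: (local_value_join rG bphi rE kE rF kF).
Qed.

Lemma bim_abs_le_unit f g : E f -> F g ->
  exists C : R, 0 <= C /\ abs_le (le := le) (phi f g) (C *: e).
Proof.
move=> Ef Fg; have [M [M0 fM]] := Criesz_bound rE cX Ef; have [N [N0 gN]] := Criesz_bound rF cY Fg.
exists (M * N); split; first exact: mulr_ge0.
have := bim_abs_le rG bphi rE kE rF Ef (kE M) Fg (kF N) fM gN.
by rewrite (bim_cstl bphi kE M (kF N)) (bim_cstr bphi kF N (kE 1)) scalerA.
Qed.

(** The values lie in the order ideal of [e], so that disjointness from [e] will force vanishing. *)
Lemma graph_abs_le h v : graph h v -> exists C : R, 0 <= C /\ abs_le (le := le) v (C *: e).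
Proof.
have e0 : le 0 e by apply: (bim_unit_ge0 rG bphi kE kF).
elim=> [f g Ef Fg|h1 h2 v1 v2 _ [C1 [C10 l1]] _ [C2 [C20 l2]]|
        a h1 v1 _ [C1 [C10 l1]]|h1 h2 v1 v2 _ [C1 [C10 l1]] _ [C2 [C20 l2]]].
- exact: bim_abs_le_unit.
- exists (C1 + C2); rewrite addr_ge0 // scalerDl; split=> //.
  exact: (abs_leD rG).
- exists (`|a| * C1); rewrite mulr_ge0 // -scalerA; split=> //.
  exact: (abs_leZ rG).
- exists (C1 + C2); rewrite addr_ge0 // scalerDl; split=> //.
  have := abs_le_join rG (v := v1) (v' := v2) (v1 := 0) (v1' := 0).
  rewrite !subr0 (gjoin_idPr rG (gle_refl rG 0)) subr0; exact.
Qed.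

(* Sum finitely many p over X for fixed y0, then finitely many q over Y. *)
Lemma disj_unit_local t : le 0 t ->
  (forall x0 y0, exists p q, [/\ fpos E p, fpos F q, 0 < p x0, 0 < q y0 &
     disj (le := le) t (phi p q)]) -> disj (le := le) t e.
Proof.
move=> t0 loc.
have pos p q : fpos E p -> fpos F q -> le 0 (phi p q) by apply: (bim_ge0 rG bphi kE).
have E0 := fpos_cst kE (lexx 0); have F0 := fpos_cst kF (lexx 0).
have E1 := fpos_cst kE ler01; have F1 := fpos_cst kF ler01.
have [cE _ _ _ _] := rE; have [cF _ _ _ _] := rF.
have disj0 : disj (le := le) t 0 by move=> z.
have slice y0 : exists q, [/\ fpos F q, 0 < q y0 & disj (le := le) t (phi (fun _ => 1) q)].
  (* [q] may vary with [p]; for a sum the minimum of the two [q] works, still positive at [y0]. *)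
  pose Q p := fpos E p /\ exists q, [/\ fpos F q, 0 < q y0 & disj (le := le) t (phi p q)].
  have [||||x0|p [[Ep [q [Fq q0 tpq]]] p1]] := compact_sum_ge1 (Q := Q) cX.
  - by move=> p [[Ep p0] _]; split=> //; apply: cE.
  - split=> //; exists (fun _ => 1); split=> //.
    by rewrite (bim0l bphi kE) //; apply: F1.1.
  - move=> p p' [Ep [q [Fq q0 tq]]] [Ep' [q' [Fq' q'0 tq']]].
    have Fm := fpos_min rF Fq Fq'.
    split; first exact: fposD.
    exists (fun y => Num.min (q y) (q' y)); split=> //; first by rewrite lt_min q0.
    rewrite (bimDl bphi); [|exact: Ep.1|exact: Ep'.1|exact: Fm.1].
    apply: disjC; apply: (disjD rG); first exact: pos.
      apply: disjC; apply: (disjW rG tq); first exact: (gle_refl rG).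
      by apply: (bim_ler rG bphi Ep Fm.1 Fq.1) => y; rewrite ge_min lexx.
    apply: disjC; apply: (disjW rG tq'); first exact: (gle_refl rG).
    by apply: (bim_ler rG bphi Ep' Fm.1 Fq'.1) => y; rewrite ge_min lexx orbT.
  - move=> a p a0 [Ep [q [Fq q0 tq]]]; split; first exact: fposZ.
    exists q; split=> //; rewrite (bimZl bphi) //; [|exact: Ep.1|exact: Fq.1].
    by apply: disjC; apply: (disjZ rG) => //; [apply: pos|apply: disjC].
  - have [p [q [Ep Fq p0 q0 tpq]]] := loc x0 y0.
    by exists p; split=> //; split=> //; exists q.
  (* From [1 <= p], phi(1,q) <= phi(p,q). *)
  exists q; split=> //; apply: (disjW rG tpq); first exact: (gle_refl rG).
  by apply: (bim_lel rG bphi) => //; apply: Ep.1.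
pose Q q := fpos F q /\ disj (le := le) t (phi (fun _ => 1) q).
have [||||y0|q [[Fq tq] q1]] := compact_sum_ge1 (Q := Q) cY.
- by move=> q [[Fq q0] _]; split=> //; apply: cF.
- by split=> //; rewrite (bim0r bphi kF).
- move=> q q' [Fq tq] [Fq' tq']; split; first exact: fposD.
  rewrite (bimDr bphi) //; [|exact: Fq.1|exact: Fq'.1].
  by apply: disjC; apply: (disjD rG); [apply: pos|apply: disjC..].
- move=> a q a0 [Fq tq]; split; first exact: fposZ.
  rewrite (bimZr bphi) //; last exact: Fq.1.
  by apply: disjC; apply: (disjZ rG) => //; [apply: pos|apply: disjC].
- by have [q [Fq q0 tq]] := slice y0; exists q.
apply: (disjW rG tq); first exact: (gle_refl rG).
by apply: (bim_ler rG bphi) => //; apply: Fq.1.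
Qed.

Lemma graph0 v : graph (fun _ => 0) v -> v = 0.
Proof.
move=> gv; have e0 : le 0 e by apply: (bim_unit_ge0 rG bphi kE kF).
apply: (abs_le_small (e := e) rG aG) => eps eps0.
(* This is the positive part of |v| - eps e. The bound [tP] is used twice: with the local error [s]
   for disjointness, and with [C *: e] for domination. *)
pose t := join 0 (join (v - eps *: e) (- v - eps *: e)).
have tP u : le 0 u -> le v (u + eps *: e) -> le (- v) (u + eps *: e) -> le t u.
  move=> u0 vu Nvu; apply: (gjoin_le rG) => //.
  by apply: (gjoin_le rG); apply/(gle_subl rG).
have t0 : le 0 t by apply: (gle_joinl rG).
have te : disj (le := le) t e.
  apply: disj_unit_local => // x0 y0.
  have [p [q [Ep Fq p0 q0 [s [s0 sw]]]]] := graph_local_value x0 y0 gv eps0.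
  rewrite scale0r subr0 addrC => -[vs Nvs]; exists p, q; split=> //.
  by apply: (disjW rG sw); [apply: tP|apply: (gle_refl rG)].
have [C [C0 [vC NvC]]] := graph_abs_le gv.
have eps_e0 : le 0 (eps *: e) by apply: (gleZ_ge0 rG) => //; apply: ltW.
have tz : t = 0.
  apply: (disj_multiple rG C0 t0 e0 te); apply: tP; first exact: (gleZ_ge0 rG).
    by apply: (gle_trans rG vC); apply: (gle_addr rG).
  by apply: (gle_trans rG NvC); apply: (gle_addr rG).
have jt : le (join (v - eps *: e) (- v - eps *: e)) 0 by rewrite -tz; apply: (gle_joinr rG).
split; rewrite -[eps *: e]add0r -(gle_subl rG); apply: (gle_trans rG _ jt).
  exact: (gle_joinl rG).
exact: (gle_joinr rG).
Qed.

(** The graph is closed under differences, so it contains the pair of 0 and [v - v']. *)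
Lemma graph_functional h v v' : graph h v -> graph h v' -> v = v'.
Proof.
move=> gv gv'; apply/eqP; rewrite -subr_eq0 -scaleN1r; apply/eqP.
apply: graph0; have := graphD gv (graphZ (-1) gv').
by congr tensor_graph; apply/funext => z; rewrite mulN1r subrr.
Qed.

Lemma graph_inj0 h : bi_injective E F phi -> graph h 0 -> forall z, h z = 0.
Proof.
move=> inj gh [x0 y0]; apply/eqP/negPn/negP => c0; set c := h (x0, y0) in c0.
have e0 : le 0 e by apply: (bim_unit_ge0 rG bphi kE kF).
(* With this [eps], |c| e <= (|c|/2) e + s, which leaves (|c|/2) e <= s. *)
have c20 : 0 < `|c| / 2 by rewrite divr_gt0 // normr_gt0.
have [p [q [Ep Fq p0 q0 [s [s0 sw ces]]]]] := graph_local_value x0 y0 gh c20.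
have es : le ((`|c| / 2) *: e) s.
  have : le (`|c| *: e) ((`|c| / 2) *: e + s).
    move: ces; rewrite -/c; set u := _ + s; rewrite sub0r => -[]; rewrite opprK -scaleNr => ? ?.
    by case: (ger0P c).
  by rewrite {1}[`|c|]splitr scalerDl (addrC _ s) -(gle_subl rG) addrK.
have pq0 : le 0 (phi p q) by apply: (bim_ge0 rG bphi kE).
have pqe : disj (le := le) (phi p q) e.
  apply: disjC; have -> : e = (`|c| / 2)^-1 *: ((`|c| / 2) *: e).
    by rewrite scalerA mulVf ?gt_eqF // scale1r.
  apply: (disjZ rG) => //; first by rewrite invr_ge0 ltW.
    by apply: (gleZ_ge0 rG) => //; apply: ltW.
  by apply: (disjW rG sw) => //; apply: (gle_refl rG).
have [C [C0 [pqC _]]] := bim_abs_le_unit Ep.1 Fq.1.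
have pqz := disj_multiple rG C0 pq0 e0 pqe pqC.
by case: (inj _ _ Ep.1 Fq.1 pqz) => z0; [move: p0|move: q0]; rewrite z0 ltxx.
Qed.

End Factorization.

(** * From the graph to the homomorphism *)

Theorem theorem3p4 (R : realType) (X Y : topologicalType)
  (cX : compact [set: X]) (hX : hausdorff_space X)
  (cY : compact [set: Y]) (hY : hausdorff_space Y)
  (E : (X -> R) -> Prop) (F : (Y -> R) -> Prop)
  (rE : Criesz_subspace E) (rF : Criesz_subspace F)
  (dE : sup_dense E) (dF : sup_dense F)
  (kE : contains_constants E) (kF : contains_constants F)
  (G : lmodType R) (leG : G -> G -> Prop) (joinG : G -> G -> G)
  (rG : riesz_space leG joinG) (aG : archimedean_riesz leG)
  (phi : (X -> R) -> (Y -> R) -> G)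
  (bphi : riesz_bimorphism joinG E F phi) :
  exists T : (X * Y -> R) -> G,
    [/\ riesz_hom_on joinG (tensor_chi E F) T,
        (forall f g, E f -> F g -> phi f g = T (chi f g)),
        (forall T' : (X * Y -> R) -> G,
            riesz_hom_on joinG (tensor_chi E F) T' ->
            (forall f g, E f -> F g -> phi f g = T' (chi f g)) ->
            forall h, tensor_chi E F h -> T' h = T h)
      & (bi_injective E F phi ->
           [/\ (forall h h', tensor_chi E F h -> tensor_chi E F h' ->
                  T h = T h' -> h = h'),
               (forall h, tensor_chi E F h -> tensor_phi joinG E F phi (T h))
             & (forall u, tensor_phi joinG E F phi u ->
                  exists h, tensor_chi E F h /\ T h = u)])].
Proof.
(* Membership goes under the existential so that choice gives a function on all of [X * Y -> R];
   outside the tensor product the witness is 0. *)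
have graph_total h : exists v, tensor_chi E F h -> tensor_graph joinG E F phi h v.
  have [th|nt] := pselect (tensor_chi E F h); last by exists 0.
  have [v gv] := tensor_chi_graph rE kE rF kF (join := joinG) (phi := phi) th.
  by exists v.
have [T TG] := choice graph_total.
have uniq h v : tensor_graph joinG E F phi h v -> v = T h.
  move=> gv; apply: (graph_functional cX cY rE kE rF kF rG aG bphi gv).
  exact: TG (graph_tensor_chi gv).
exists T; split.
- split=> [f g tf tg|a f tf|f g tf tg]; apply/esym/uniq.
  + by apply: graphD; apply: TG.
  + by apply: graphZ; apply: TG.
  + by apply: graph_join; apply: TG.
- by move=> f g Ef Fg; apply/uniq/graph_chi.
- move=> T' [TD TZ TM] Tchi h /TG; elim=> [f g Ef Fg|h1 h2 v1 v2 g1 e1 g2 e2|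
    a h1 v1 g1 e1|h1 h2 v1 v2 g1 e1 g2 e2].
  + by rewrite Tchi.
  + by rewrite TD ?e1 ?e2 //; apply: graph_tensor_chi; [exact: g1|exact: g2].
  + by rewrite TZ ?e1 //; apply: graph_tensor_chi; exact: g1.
  + by rewrite TM ?e1 ?e2 //; apply: graph_tensor_chi; [exact: g1|exact: g2].
- move=> inj; split.
  + move=> h h' th th' Thh'.
    (* The pair of [h - h'] and 0 lies in the graph. *)
    have := graphD (TG _ th) (graphZ (-1) (TG _ th')).
    rewrite Thh' scaleN1r subrr => /(graph_inj0 cX cY rE kE rF kF rG bphi inj) hh'.
    by apply/funext => z; apply/eqP; rewrite -subr_eq0 -(hh' z) mulN1r.
  + move=> h /TG gh S rS SA; case: (rS) => S0 SD SZ SJ.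
    elim: gh => [f g Ef Fg|h1 h2 v1 v2 _ S1 _ S2|a h1 v1 _ S1|h1 h2 v1 v2 _ S1 _ S2].
    * by apply: SA; exists f, g.
    * exact: SD.
    * exact: SZ.
    * exact: SJ.
  + move=> u tu; have : exists h, tensor_graph joinG E F phi h u.
      (* The range of the graph is a Riesz subspace containing the values of [phi]. *)
      apply: (tu (fun u => exists h, tensor_graph joinG E F phi h u)); first split.
      * have t0 : tensor_chi E F (fun _ => 0) by move=> S [].
        have [v gv] := tensor_chi_graph rE kE rF kF (join := joinG) (phi := phi) t0.
        (* The form [0 * 0] is what [graphZ] produces from the zero function with scalar 0. *)
        by exists (fun _ => 0 * 0); rewrite -(scale0r v); apply: graphZ gv.
      * by move=> v v' [h gv] [h' gv']; exists (fun z => h z + h' z); apply: graphD.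
      * by move=> a v [h gv]; exists (fun z => a * h z); apply: graphZ.
      * move=> v v' [h gv] [h' gv'].
        by exists (fun z => Num.max (h z) (h' z)); apply: graph_join.
      * by move=> v [f [g [Ef Fg ->]]]; exists (chi f g); apply: graph_chi.
    by move=> [h gh]; exists h; split; [apply: graph_tensor_chi gh|rewrite -(uniq _ _ gh)].
Qed.
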